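(* Let $X$ be a finite set with $|X|>1$. Then the free monoid $\mathbb{M}_X$ with basis $X$ is quasi-finitely axiomatizable (QFA) and prime. Moreover, if $\Gamma$ is a finite graph such that the free partially commutative monoid $A_\Gamma$ is non-trivial and has trivial center, then $A_\Gamma$ is QFA and prime.
   Context: For a finite graph $\Gamma$ with vertices $V$ and edges $E$, the free partially commutative monoid $A_\Gamma$ is the monoid with generators $V$ and relations $v_1v_2=v_2v_1$ for each edge $(v_1,v_2)\in E$. Fix a finite signature (here the signature of monoids). An infinite finitely generated structure $G$ is quasi-finitely axiomatizable (QFA) if there is a first-order sentence $\phi$ such that $G\models\phi$ and every finitely generated structure $H$ in the same signature with $H\models\phi$ is isomorphic to $G$. A structure $G$ is prime if $G$ is isomorphic to an elementary submodel of each structure $H$ elementarily equivalent to $G$. *)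

(* Defs.v *)
From HB Require Import structures.
From mathcomp Require Import all_boot.
From mathcomp Require Import boolp classical_sets functions cardinality.

Set Implicit Arguments.
Unset Strict Implicit.
Unset Printing Implicit Defensive.

Local Open Scope group_scope.
Local Open Scope quotient_scope.

(* A structure in the signature of monoids, one binary operation and one
   constant with no axiom imposed, is a [baseUMagmaType]. *)

Inductive mterm := MVar of nat | MOne | MMul of mterm & mterm.

Inductive mformula :=
  | MFalse
  | MEqual of mterm & mterm
  | MNot of mformula
  | MAnd of mformula & mformula
  | MOr of mformula & mformula
  | MImplies of mformula & mformula
  | MForall of nat & mformula
  | MExists of nat & mformula.

Fixpoint mterm_vars (t : mterm) : seq nat :=
  match t with
  | MVar i => [:: i]
  | MOne => [::]
  | MMul t1 t2 => mterm_vars t1 ++ mterm_vars t2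
  end.

Fixpoint free_vars (phi : mformula) : seq nat :=
  match phi with
  | MFalse => [::]
  | MEqual t1 t2 => mterm_vars t1 ++ mterm_vars t2
  | MNot psi => free_vars psi
  | MAnd psi chi | MOr psi chi | MImplies psi chi =>
      free_vars psi ++ free_vars chi
  | MForall i psi | MExists i psi => [seq j <- free_vars psi | j != i]
  end.

Definition sentence (phi : mformula) : Prop := free_vars phi = [::].

Fixpoint meval (G : baseUMagmaType) (env : nat -> G) (t : mterm) : G :=
  match t with
  | MVar i => env i
  | MOne => 1
  | MMul t1 t2 => meval env t1 * meval env t2
  end.

Definition env_upd (G : Type) (env : nat -> G) (i : nat) (x : G) : nat -> G :=
  fun j => if j == i then x else env j.

Fixpoint holds (G : baseUMagmaType) (env : nat -> G) (phi : mformula) : Prop :=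
  match phi with
  | MFalse => False
  | MEqual t1 t2 => meval env t1 = meval env t2
  | MNot psi => ~ holds env psi
  | MAnd psi chi => holds env psi /\ holds env chi
  | MOr psi chi => holds env psi \/ holds env chi
  | MImplies psi chi => holds env psi -> holds env chi
  | MForall i psi => forall x : G, holds (env_upd env i x) psi
  | MExists i psi => exists x : G, holds (env_upd env i x) psi
  end.

(* Only used for sentences, whose truth does not depend on [env]. *)
Definition models (G : baseUMagmaType) (phi : mformula) : Prop :=
  forall env : nat -> G, holds env phi.

Definition elementarily_equivalent (G H : baseUMagmaType) : Prop :=
  forall phi : mformula, sentence phi -> (models G phi <-> models H phi).

Definition isomorphic (G H : baseUMagmaType) : Prop :=
  exists2 f : G -> H, monoid_morphism f & bijective f.

Definition finitely_generated (G : baseUMagmaType) : Prop :=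
  exists (n : nat) (g : 'I_n -> G),
    forall S : {pred G}, umagma_closed S -> (forall i, g i \in S) ->
      forall x, x \in S.

Definition QFA (G : baseUMagmaType) : Prop :=
  [/\ infinite_set [set: G], finitely_generated G &
      exists phi : mformula,
        [/\ sentence phi, models G phi &
            forall H : baseUMagmaType,
              finitely_generated H -> models H phi -> isomorphic H G]].

Section Submodel.
Variables (H : baseUMagmaType) (S : {pred H}) (clS : umagma_closed S).

Definition submodel (_ : umagma_closed S) : Type := {x : H | x \in S}.

Definition submodel_one : submodel clS := exist _ 1 (proj1 clS).

Definition submodel_mul (x y : submodel clS) : submodel clS :=
  exist _ (sval x * sval y) (proj2 clS _ _ (svalP x) (svalP y)).

HB.instance Definition _ := hasMul.Build (submodel clS) submodel_mul.
HB.instance Definition _ := hasOne.Build (submodel clS) submodel_one.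

Definition elementary_submodel : Prop :=
  forall (phi : mformula) (env : nat -> submodel clS),
    holds env phi <-> holds (fun i => sval (env i)) phi.

End Submodel.

Definition prime_model (G : baseUMagmaType) : Prop :=
  forall H : baseUMagmaType, elementarily_equivalent G H ->
    exists (S : {pred H}) (clS : umagma_closed S),
      elementary_submodel clS /\ isomorphic G (submodel clS).

Definition free_monoid (X : finType) : Type := seq X.

Section FreeMonoid.
Variable X : finType.

HB.instance Definition _ := Choice.on (free_monoid X).
HB.instance Definition _ := isMonoid.Build (free_monoid X)
  (@catA X) (@cat0s X) (@cats0 X).

End FreeMonoid.

Section FreePartiallyCommutativeMonoid.
Variables (V : finType) (e : rel V).

(* The least monoid congruence containing the defining relations. *)
Inductive fpc_congr : seq V -> seq V -> Prop :=
  | fpc_edge a b : e a b -> fpc_congr [:: a; b] [:: b; a]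
  | fpc_refl u : fpc_congr u u
  | fpc_sym u v : fpc_congr u v -> fpc_congr v u
  | fpc_trans v u w : fpc_congr u v -> fpc_congr v w -> fpc_congr u w
  | fpc_cat u u' v v' :
      fpc_congr u u' -> fpc_congr v v' -> fpc_congr (u ++ v) (u' ++ v').

Definition fpc_rel : rel (seq V) := fun u v => `[< fpc_congr u v >].

Lemma fpc_rel_refl : reflexive fpc_rel.
Proof. by move=> u; apply/asboolP; apply: fpc_refl. Qed.

Lemma fpc_rel_sym : symmetric fpc_rel.
Proof. by move=> u v; apply/asboolP/asboolP; apply: fpc_sym. Qed.

Lemma fpc_rel_trans : transitive fpc_rel.
Proof.
move=> v u w /asboolP uv /asboolP vw.
by apply/asboolP; apply: fpc_trans uv vw.
Qed.

Canonical fpc_equiv := EquivRel fpc_rel fpc_rel_refl fpc_rel_sym fpc_rel_trans.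

Definition fpc_monoid : Type := {eq_quot fpc_rel}.

HB.instance Definition _ := Choice.on fpc_monoid.
HB.instance Definition _ := EqQuotient.on fpc_monoid.

Definition fpc_pi (u : seq V) : fpc_monoid := \pi_({eq_quot fpc_rel}) u.

Lemma fpc_pi_eq (u v : seq V) : fpc_pi u = fpc_pi v <-> fpc_congr u v.
Proof.
split=> [/eqmodP /asboolP //|uv].
by apply/eqmodP/asboolP.
Qed.

Lemma fpc_piK (x : fpc_monoid) : fpc_pi (repr x) = x.
Proof. exact: reprK. Qed.

Definition fpc_one : fpc_monoid := fpc_pi [::].

Definition fpc_mul (x y : fpc_monoid) : fpc_monoid := fpc_pi (repr x ++ repr y).

Lemma fpc_mul_pi (u v : seq V) : fpc_mul (fpc_pi u) (fpc_pi v) = fpc_pi (u ++ v).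
Proof. by apply/fpc_pi_eq/fpc_cat; apply/fpc_pi_eq/fpc_piK. Qed.

Lemma fpc_mulA : associative fpc_mul.
Proof.
move=> x y z; rewrite -(fpc_piK x) -(fpc_piK y) -(fpc_piK z).
move: (repr x) (repr y) (repr z) => u v w.
by rewrite (fpc_mul_pi v w) (fpc_mul_pi u v) !fpc_mul_pi catA.
Qed.

Lemma fpc_mul1 : left_id fpc_one fpc_mul.
Proof. by move=> x; rewrite -(fpc_piK x) (fpc_mul_pi [::]). Qed.

Lemma fpc_mulr1 : right_id fpc_one fpc_mul.
Proof. by move=> x; rewrite -(fpc_piK x) (fpc_mul_pi _ [::]) cats0. Qed.

HB.instance Definition _ :=
  isMonoid.Build fpc_monoid fpc_mulA fpc_mul1 fpc_mulr1.

End FreePartiallyCommutativeMonoid.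

Definition center (G : baseUMagmaType) : set G :=
  [set z | forall x : G, commute z x].

Arguments center G : clear implicits.

(* Main.v *)
Require Import Defs.
From mathcomp Require Import all_boot.
From mathcomp Require Import boolp classical_sets.
From mathcomp Require Import cardinality.

Set Implicit Arguments.
Unset Strict Implicit.
Unset Printing Implicit Defensive.

(** In a trace monoid the generators are exactly the atoms (irreducible
    elements), and two atoms commute iff they are equal or adjacent.

    QFA: in a finitely generated monoid where [x = u * x * v] forces
    [u = v = 1], a generator that is not an atom is a product of the others,
    so the atoms generate.  Levi's lemma for atoms ([a * x = b * y] implies
    [a = b] and [x = y], or [a] and [b] commute and [x = b * z], [y = a * z]) is a
    first-order property that leaves no relations but the commutations.

    Primality: a tuple enumerating the atoms with the prescribed commutation
    graph is unique up to automorphism, so the type of the tuple of generators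
    is isolated, and a realisation of it in an elementarily equivalent [H]
    generates an elementary submodel.

    The free monoid is the case of the graph without edges. *)

Local Open Scope group_scope.

(** * First-order semantics: dependence on free variables, isomorphism invariance, universal
    closure *)

Lemma env_upd_agree (G : Type) (s : seq nat) (env env' : nat -> G) i x :
    {in [seq j <- s | j != i], env =1 env'} ->
  {in s, env_upd env i x =1 env_upd env' i x}.
Proof.
move=> E j sj; rewrite /env_upd; case: eqP => // /eqP ji.
by apply: E; rewrite mem_filter ji.
Qed.

Lemma meval_agree (G : baseUMagmaType) (env env' : nat -> G) t :
  {in mterm_vars t, env =1 env'} -> meval env t = meval env' t.
Proof.
elim: t => [i|//|t1 IH1 t2 IH2] /= E; first by apply: E; rewrite mem_head.
by rewrite IH1 ?IH2 // => j tj; apply: E; rewrite mem_cat tj ?orbT.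
Qed.

Lemma holds_agree (G : baseUMagmaType) phi (env env' : nat -> G) :
  {in free_vars phi, env =1 env'} -> holds env phi <-> holds env' phi.
Proof.
have L (s t : seq nat) (a b : nat -> G) :
  {in s ++ t, a =1 b} -> {in s, a =1 b} by move=> E j sj; rewrite E ?mem_cat ?sj.
have R (s t : seq nat) (a b : nat -> G) :
  {in s ++ t, a =1 b} -> {in t, a =1 b}
  by move=> E j tj; rewrite E ?mem_cat ?tj ?orbT.
elim: phi env env' => [|t1 t2|p IH|p IHp q IHq|p IHp q IHq|p IHp q IHq|i p IH|i p IH]
  env env' //= E.
- by rewrite (meval_agree (L _ _ _ _ E)) (meval_agree (R _ _ _ _ E)).
- by have := IH _ _ E; tauto.
- by have := IHp _ _ (L _ _ _ _ E); have := IHq _ _ (R _ _ _ _ E); tauto.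
- by have := IHp _ _ (L _ _ _ _ E); have := IHq _ _ (R _ _ _ _ E); tauto.
- by have := IHp _ _ (L _ _ _ _ E); have := IHq _ _ (R _ _ _ _ E); tauto.
- by split=> h x; apply/(IH _ _ (env_upd_agree x E)).
- by split=> -[x h]; exists x; apply/(IH _ _ (env_upd_agree x E)).
Qed.

Lemma holds_iso (G H : baseUMagmaType) (f : G -> H) :
    monoid_morphism f -> bijective f ->
  forall phi env, holds env phi <-> holds (f \o env) phi.
Proof.
move=> [f1 fM] [g fK gK].
have fE env t : meval (f \o env) t = f (meval env t).
  by elim: t => //= t1 -> t2 ->; rewrite fM.
have fU env i x : f \o env_upd env i x = env_upd (f \o env) i (f x).
  by apply: funext => j; rewrite /= /env_upd; case: eqP.
elim=> [|t1 t2|p IH|p IHp q IHq|p IHp q IHq|p IHp q IHq|i p IH|i p IH] env //=.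
- by rewrite !fE; split=> [->//|/(can_inj fK)].
- by have := IH env; tauto.
- by have := IHp env; have := IHq env; tauto.
- by have := IHp env; have := IHq env; tauto.
- by have := IHp env; have := IHq env; tauto.
- split=> h x; last by apply/IH; rewrite fU.
  by rewrite -(gK x) -fU; apply/IH.
- split=> [[x h]|[x h]]; first by exists (f x); rewrite -fU; apply/IH.
  by exists (g x); apply/IH; rewrite fU gK.
Qed.

Lemma isomorphic_sym (G H : baseUMagmaType) : isomorphic G H -> isomorphic H G.
Proof.
move=> [f [f1 fM] [g fK gK]]; exists g; last by exists f.
split=> [|x y]; first by rewrite -f1 fK.
by apply: (can_inj fK); rewrite fM !gK.
Qed.

(** The axioms below are open formulas, whereas [QFA] and [elementarily_equivalent] speak of
    sentences only; the universal closure bridges the two. *)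
Definition all_close phi := foldr MForall phi (free_vars phi).

Lemma all_close_sentence phi : sentence (all_close phi).
Proof.
rewrite /sentence /all_close.
suff -> s : free_vars (foldr MForall phi s) = [seq j <- free_vars phi | j \notin s].
  by rewrite (@eq_in_filter _ _ pred0) ?filter_pred0 // => j ->.
elim: s => [|i s IH] /=; first by rewrite filter_predT.
by rewrite IH -filter_predI; apply: eq_filter => j; rewrite /= inE negb_or.
Qed.

Lemma holds_all_close (G : baseUMagmaType) phi (env : nat -> G) :
  holds env (all_close phi) <-> forall env' : nat -> G, holds env' phi.
Proof.
have key (s : seq nat) (env' : nat -> G) : holds env' (foldr MForall phi s) <->
    forall env'', (forall j, j \notin s -> env'' j = env' j) -> holds env'' phi.
  elim: s env' => [|i s IH] env' /=.
    split=> [h env'' E|]; last by apply.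
    by have -> : env'' = env' by apply: funext => j; apply: E.
  split=> [h env'' E|h x].
    apply: (proj1 (IH _) (h (env'' i))) => j js; rewrite /env_upd; case: eqP => [->//|/eqP ji].
    by apply: E; rewrite inE negb_or ji.
  apply/IH => env'' E; apply: h => j; rewrite inE negb_or => /andP[ji js].
  by rewrite E // /env_upd (negPf ji).
rewrite key; split=> h env'; last by move=> _; apply: h.
(* [key] only reaches environments that agree with [env] off the free variables, so [env'] is
   altered there, which does not affect [phi]. *)
apply/(holds_agree (env' := fun j => if j \in free_vars phi then env' j else env j)).
  by move=> j ->.
by apply: h => j /negPf ->.
Qed.

Lemma models_all_close (G : baseUMagmaType) phi :
  models G (all_close phi) <-> models G phi.
Proof.
split=> h; last by move=> env; apply/holds_all_close.
by apply/(holds_all_close phi (fun=> 1)); apply: h.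
Qed.

Lemma elementarily_equivalent_models (G H : baseUMagmaType) phi :
  elementarily_equivalent G H -> models G phi <-> models H phi.
Proof.
move=> GH; rewrite -(models_all_close G) -(models_all_close H).
exact: GH (all_close_sentence phi).
Qed.

Definition all_in (T : Type) (s : seq T) (f : T -> mformula) :=
  foldr (fun x => MAnd (f x)) (MNot MFalse) s.

Lemma holds_all_in (G : baseUMagmaType) (T : eqType) (s : seq T) f (env : nat -> G) :
  holds env (all_in s f) <-> {in s, forall x, holds env (f x)}.
Proof.
elim: s => [|x s IH] /=; first by split=> // _ [].
split=> [[hx /IH hs] y|h].
  by rewrite inE => /predU1P[->|/hs].
split; first by apply: h; rewrite mem_head.
by apply/IH => y ys; apply: h; rewrite inE ys orbT.
Qed.

(** * Atoms and the first-order axioms of trace monoids *)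

Definition atom (G : baseUMagmaType) (x : G) :=
  x <> 1 /\ forall y z, x = y * z -> y = 1 \/ z = 1.

(** Variables [0] and [1] are bound here, so the formula has its intended meaning only for
    [i >= 2]. *)
Definition atomF i :=
  MAnd (MNot (MEqual (MVar i) MOne))
    (MForall 0 (MForall 1 (MImplies
       (MEqual (MVar i) (MMul (MVar 0) (MVar 1)))
       (MOr (MEqual (MVar 0) MOne) (MEqual (MVar 1) MOne))))).

Lemma holds_atomF (G : baseUMagmaType) (env : nat -> G) i :
  holds env (atomF i.+2) <-> atom (env i.+2).
Proof. by []. Qed.

(** The fourth clause is a first-order substitute for additive length; at [x = 1] it forbids
    nontrivial units. *)
Definition trace_axioms (G : baseUMagmaType) :=
  [/\ associative (@mul G), left_id 1 (@mul G), right_id 1 (@mul G),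
      forall x u v : G, x = u * x * v -> u = 1 /\ v = 1
    & forall a b x y : G, atom a -> atom b -> a * x = b * y ->
        a = b /\ x = y \/
        a * b = b * a /\ exists z, x = b * z /\ y = a * z].

Definition trace_axiomsF :=
  let x i := MVar i in
  MAnd (MEqual (MMul (x 2) (MMul (x 3) (x 4))) (MMul (MMul (x 2) (x 3)) (x 4)))
  (MAnd (MEqual (MMul MOne (x 2)) (x 2))
  (MAnd (MEqual (MMul (x 2) MOne) (x 2))
  (MAnd (MImplies (MEqual (x 2) (MMul (MMul (x 3) (x 2)) (x 4)))
           (MAnd (MEqual (x 3) MOne) (MEqual (x 4) MOne)))
    (MImplies (atomF 2) (MImplies (atomF 3)
       (MImplies (MEqual (MMul (x 2) (x 4)) (MMul (x 3) (x 5)))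
          (MOr (MAnd (MEqual (x 2) (x 3)) (MEqual (x 4) (x 5)))
             (MAnd (MEqual (MMul (x 2) (x 3)) (MMul (x 3) (x 2)))
                (MExists 0 (MAnd (MEqual (x 4) (MMul (x 3) (x 0)))
                   (MEqual (x 5) (MMul (x 2) (x 0))))))))))))).

Lemma models_trace_axiomsF (G : baseUMagmaType) :
  models G trace_axiomsF <-> trace_axioms G.
Proof.
split=> [h|[mA m1 m1r irr levi] env]; last first.
  split; [exact: mA|split; [exact: m1|split; [exact: m1r|split; [exact: irr|]]]].
  by move=> /holds_atomF a2 /holds_atomF a3; apply: levi.
(* Entries [0] and [1] are dummies: those variables are reserved for quantifiers. *)
pose env (a b x y : G) i := nth 1 [:: 1; 1; a; b; x; y] i.
split=> [x y z|x|x|x u v|a b x y ha hb].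
- by have [] := h (env x y z 1).
- by have [_ []] := h (env x 1 1 1).
- by have [_ [_ []]] := h (env x 1 1 1).
- by have [_ [_ [_ []]]] := h (env x u v 1).
- have [_ [_ [_ [_ H]]]] := h (env a b x y).
  by apply: H; apply/holds_atomF.
Qed.

(** * Words, tuples of atoms with a prescribed graph, and presentations *)

Section Presentation.
Variables (V : finType) (e : rel V).

Fixpoint eval (G : baseUMagmaType) (I : Type) (g : I -> G) (w : seq I) : G :=
  if w is i :: w' then g i * eval g w' else 1.

Lemma eval_cat (G : baseUMagmaType) I (g : I -> G) u v : trace_axioms G ->
  eval g (u ++ v) = eval g u * eval g v.
Proof. by move=> [mA m1 _ _ _]; elim: u => //= i u ->; rewrite mA. Qed.

Definition graph_of_atoms (G : baseUMagmaType) (g : V -> G) :=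
  [/\ injective g, forall v, atom (g v), forall x, atom x -> exists v, x = g v
    & forall v w, commute (g v) (g w) <-> (v == w) || e v w].

(* Variables [0], [1], [2] are kept for the quantifiers of [graph_of_atomsF]. *)
Definition vvar N (v : V) := (N + enum_rank v).+3.

(** The tests [v == w] and [e v w] are decided outside the logic, and the finite disjunction over
    [V] is a negated conjunction. The offset [N] keeps the tuple apart from the variables of another
    formula. *)
Definition graph_of_atomsF N :=
  MAnd (all_in (enum V) (fun v => atomF (vvar N v)))
  (MAnd (MForall 2 (MImplies (atomF 2)
           (MNot (all_in (enum V) (fun v => MNot (MEqual (MVar 2) (MVar (vvar N v))))))))
    (all_in (enum V) (fun v => all_in (enum V) (fun w =>
       MAnd (MImplies (MEqual (MVar (vvar N v)) (MVar (vvar N w)))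
               (if v == w then MNot MFalse else MFalse))
         (let c := MEqual (MMul (MVar (vvar N v)) (MVar (vvar N w)))
                     (MMul (MVar (vvar N w)) (MVar (vvar N v))) in
          if (v == w) || e v w then c else MNot c))))).

Lemma holds_graph_of_atomsF (G : baseUMagmaType) (env : nat -> G) N :
  holds env (graph_of_atomsF N) <-> graph_of_atoms (fun v => env (vvar N v)).
Proof.
split.
  move=> [/holds_all_in h1 [h2 /holds_all_in h3]].
  have h v w : holds env _ := proj1 (holds_all_in _ _ _) (h3 v (mem_enum _ v)) w (mem_enum _ w).
  split.
  - by move=> v w E; have [/= + _] := h v w => /(_ E); case: eqP.
  - by move=> v; apply/holds_atomF/h1/mem_enum.
  - move=> x hx; apply: contrapT => no.
    have /= := h2 x (proj2 (holds_atomF (env_upd env 2 x) 0) hx); apply.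
    by apply/holds_all_in => v _ /= E; apply: no; exists v.
  - by move=> v w; have [_] := h v w; rewrite /commute; case: ifP.
move=> [inj at1 at2 com]; split; [|split].
- by apply/holds_all_in => v _; apply/holds_atomF/at1.
- move=> x /holds_atomF /at2 [v E] /holds_all_in /(_ v (mem_enum _ v)) /=.
  by apply.
- apply/holds_all_in => v _; apply/holds_all_in => w _; split=> /=.
    by move=> /inj ->; rewrite eqxx /=.
  by have := com v w; rewrite /commute; case: ifP => _ /= [h1 h2]; [apply: h2|move/h1].
Qed.

Definition presents (G : baseUMagmaType) (p : seq V -> G) :=
  [/\ p [::] = 1, forall u v, p (u ++ v) = p u * p v,
      forall x, exists u, p u = x
    & forall u v, p u = p v <-> fpc_congr e u v].

(** * Combinatorics of trace equivalence: left division by a letter and Levi's lemma *)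

Hypothesis e_sym : symmetric e.

(** The relations only reorder letters, so length and letter multiplicities are invariants of a
    trace. *)
Lemma fpc_congr_perm u v : fpc_congr e u v -> perm_eq u v.
Proof.
elim=> [a b _|//|{}u {}v _|{}v {}u w _ uv _|{}u u' {}v v' _ uu _ vv].
- by rewrite (perm_catC [:: a] [:: b]).
- by rewrite perm_sym.
- exact: perm_trans uv.
- exact: perm_cat.
Qed.

Lemma fpc_congr_cons a u v : fpc_congr e u v -> fpc_congr e (a :: u) (a :: v).
Proof. exact: (fpc_cat (fpc_refl e [:: a])). Qed.

(* [del a u] removes from [u] the first occurrence of [a] when all letters
   before it commute with [a], i.e. it divides [u] by [a] on the left. *)
Fixpoint del a (u : seq V) : option (seq V) :=
  if u is x :: u' then
    if x == a then Some u'
    else if e a x then omap (cons x) (del a u') else None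
  else None.

Lemma del_cat a u v : del a (u ++ v) =
  if del a u is Some u' then Some (u' ++ v)
  else if all (e a) u then omap (cat u) (del a v) else None.
Proof.
elim: u => [|x u IH] /=; first by case: (del _ _).
case: eqP => [_//|_]; case: (e a x) => //=.
by rewrite IH; case: (del a u) => //=; case: all => //; case: (del _ _).
Qed.

Lemma del_congr a u v : fpc_congr e u v ->
  match del a u, del a v with
  | Some u', Some v' => fpc_congr e u' v'
  | None, None => True
  | _, _ => False
  end.
Proof.
elim=> [x y exy|{}u|{}u {}v _|{}v {}u w _ + _|{}u u' {}v v' uu' + vv' +] /=.
- have [xa|xa] := eqVneq x a; have [ya|ya] := eqVneq y a.
  + by rewrite xa ya; apply: fpc_refl.
  + by rewrite -xa exy; apply: fpc_refl.
  + by rewrite -ya e_sym exy; apply: fpc_refl.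
  + by case: (e a x); case: (e a y).
- by case: (del _ _) => // ?; apply: fpc_refl.
- by do 2 case: (del _ _) => [?|]; rewrite //; apply: fpc_sym.
- by do 3 case: (del _ _) => [?|] //; apply: fpc_trans.
(* Whether [a] can pass through the whole left factor depends only on its letters, which congruence
   preserves. *)
rewrite !del_cat (perm_all _ (fpc_congr_perm uu')).
case: (del a u) => [?|]; case: (del a u') => [?|] // h; first by move=> _; apply: fpc_cat.
by case: all => //; do 2 case: (del _ _) => [?|] //=; apply: fpc_cat.
Qed.

Lemma del_someP a u w : del a u = Some w -> fpc_congr e u (a :: w).
Proof.
elim: u w => [//|x u IH] w /=; have [->|_] := eqVneq x a.
  by case=> ->; apply: fpc_refl.
case: ifP => // eax; case E: (del a u) => [w'|//] [<-].
apply: fpc_trans (fpc_congr_cons x (IH _ E)) _.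
by apply: (fpc_cat (fpc_edge _) (fpc_refl e w')); rewrite e_sym.
Qed.

(** Divide both sides by [a]: the left gives [u]; if [b] differs from [a], the right succeeds only
    when [a] moves past [b] and divides [v]. *)
Lemma fpc_levi a b u v : fpc_congr e (a :: u) (b :: v) ->
  a = b /\ fpc_congr e u v \/
  e a b /\ exists w, fpc_congr e u (b :: w) /\ fpc_congr e v (a :: w).
Proof.
move=> /(del_congr a) /=; rewrite eqxx; have [->|ba] := eqVneq b a; first by left.
case: ifP => // eab; case E: (del a v) => [w|//] /= uw.
by right; split=> //; exists w; split=> //; apply: del_someP.
Qed.

(** * Monoids presented by the graph satisfy the axioms, and the axioms determine them *)

Section Presented.
Variables (G : baseUMagmaType) (p : seq V -> G).
Hypothesis pP : presents p.

Lemma presents_perm u v : p u = p v -> perm_eq u v.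
Proof. by have [_ _ _ pE] := pP => /pE/fpc_congr_perm. Qed.

Lemma presents_eq1 u : p u = 1 -> u = [::].
Proof.
by have [p1 _ _ _] := pP; rewrite -p1 => /presents_perm/perm_size/size0nil.
Qed.

Lemma presents_atomP x : atom x <-> exists v, x = p [:: v].
Proof.
have [p1 pM ps pE] := pP; split.
  have [[|v w] <-] := ps x; first by rewrite p1 => -[].
  have := pM [:: v] w; rewrite /= => -> [_ /(_ _ _ erefl)].
  case=> /presents_eq1 // ->; exists v.
  by rewrite -pM.
move=> [v ->]; split=> [/presents_eq1//|y z].
have [s <-] := ps y; have [t <-] := ps z; rewrite -pM => /presents_perm/perm_size.
rewrite size_cat; case: s => [|? s]; first by left.
case: t => [|? t]; first by right.
by rewrite /= addnS.
Qed.

Lemma presents_graph_of_atoms : graph_of_atoms (fun v => p [:: v]).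
Proof.
have [p1 pM ps pE] := pP; split.
- by move=> v w /presents_perm /perm_mem /(_ v); rewrite !inE eqxx => /esym/eqP.
- by move=> v; apply/presents_atomP; exists v.
- by move=> x /presents_atomP.
- move=> v w; rewrite /commute -!pM pE /=; split.
    by case/fpc_levi => [[-> _]|[-> _]]; rewrite ?eqxx ?orbT.
  by case/predU1P => [->|/fpc_edge //]; apply: fpc_refl.
Qed.

Lemma presents_trace_axioms : trace_axioms G.
Proof.
have [p1 pM ps pE] := pP; split.
- move=> x y z; have [u <-] := ps x; have [v <-] := ps y; have [w <-] := ps z.
  by rewrite -!pM catA.
- by move=> x; have [u <-] := ps x; rewrite -p1 -pM.
- by move=> x; have [u <-] := ps x; rewrite -p1 -pM cats0.
- move=> x y z; have [u <-] := ps x; have [v <-] := ps y; have [w <-] := ps z.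
  (* Comparing lengths leaves [size v + size w = 0]. *)
  rewrite -!pM => /presents_perm/perm_size/eqP; rewrite !size_cat.
  rewrite addnAC -[eqbLHS]add0n eqn_add2r eq_sym addn_eq0 !size_eq0.
  by case/andP=> /eqP -> /eqP ->.
move=> _ _ x y /presents_atomP[a ->] /presents_atomP[b ->].
have [u <-] := ps x; have [v <-] := ps y; rewrite -!pM => /pE/fpc_levi[].
  by case=> -> /pE ->; left.
case=> eab [w [/pE -> /pE ->]]; right; split.
  by apply/pE/fpc_edge.
by exists (p w); rewrite -!pM.
Qed.

Lemma presents_eval u : p u = eval (fun v => p [:: v]) u.
Proof.
have [p1 pM _ _] := pP; elim: u => [//|v u IH].
by rewrite /= -IH -pM.
Qed.

Lemma presents_fg : finitely_generated G.
Proof.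
have [p1 pM ps _] := pP.
exists #|V|, (fun i => p [:: enum_val i]) => S [S1 SM] Sg x.
have [u <-] := ps x; rewrite presents_eval; elim: u => [//|v u IH] /=.
by apply: SM => //; rewrite -(enum_rankK v).
Qed.

(** The powers of one letter are separated by their lengths. *)
Lemma presents_infinite : V -> infinite_set [set: G]%classic.
Proof.
move=> v finG; apply: infinite_nat.
apply: (@finite_preimage _ _ setT (fun k => p (nseq k v))) finG.
by move=> k l _ _ /presents_perm/perm_size; rewrite !size_nseq.
Qed.

(** Induction on the length of [u]: Levi's clause compares the first letters, and the element [z] it
    produces is spelled as a word thanks to generation. *)
Lemma presents_eval_congr (H : baseUMagmaType) (h : V -> H) u v :
    trace_axioms H -> graph_of_atoms h ->
    (forall x, exists w, x = eval h w) ->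
  eval h u = eval h v <-> fpc_congr e u v.
Proof.
move=> axH hgr gen; have [inj hat _ hcom] := hgr.
have [mA m1 m1r irr levi] := axH; split; last first.
  elim=> [a b eab|//|//|{}u {}v w _ -> _ ->//|{}u u' {}v v' _ Eu _ Ev].
    have /= := proj2 (hcom a b); rewrite eab orbT => /(_ isT) com.
    by rewrite !m1r.
  by rewrite !eval_cat // Eu Ev.
have eval1 a w : eval h (a :: w) <> 1.
  move=> /= E; have [] := hat a => + _; apply.
  by have [] := irr 1 (h a) (eval h w) _; rewrite ?m1r.
have [n] := ubnP (size u); elim: n u v => // n IH [|a u] [|b v] /=.
- by move=> *; apply: fpc_refl.
- by move=> _ /esym/eval1.
- by move=> _ /eval1.
rewrite ltnS => ltn /(levi _ _ _ _ (hat a) (hat b))[[ab E]|].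
  have <- : a = b by apply: inj.
  exact/fpc_congr_cons/IH.
case=> /hcom ab [z]; have [w ->] := gen z => -[Eu Ev].
have uw : fpc_congr e u (b :: w) by apply: IH.
have vw : fpc_congr e v (a :: w).
  (* The induction bounds the left word, so the sides are swapped: [a :: w] is as long as [u], which
     is congruent to [b :: w]. *)
  apply/fpc_sym/IH => //; apply: leq_trans ltn.
  by rewrite (perm_size (fpc_congr_perm uw)).
apply: fpc_trans (fpc_congr_cons a uw) _.
apply: fpc_trans (fpc_sym (fpc_congr_cons b vw)).
case/predU1P: ab => [->|ab]; first exact: fpc_refl.
exact: (fpc_cat (fpc_edge ab) (fpc_refl e w)).
Qed.

(** [p] and [eval h] identify the same words, so the map does not depend on the section [rep], which
    need not be multiplicative. *)
Lemma presents_eval_iso (H : baseUMagmaType) (h : V -> H) (rep : G -> seq V) :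
    trace_axioms H -> graph_of_atoms h ->
    (forall x, exists w, x = eval h w) -> cancel rep p ->
  monoid_morphism (eval h \o rep) /\ bijective (eval h \o rep).
Proof.
move=> axH hgr gen repK; have [p1 pM ps pE] := pP.
have E u v : eval h u = eval h v <-> p u = p v.
  by rewrite pE; apply: presents_eval_congr.
split; first split=> [|x y] /=.
- by apply: (proj2 (E _ [::])); rewrite repK.
- by rewrite -eval_cat //; apply/E; rewrite pM !repK.
have [g gK] := choice gen.
exists (p \o g) => x /=; first by rewrite -[RHS]repK; apply/E; rewrite -gK.
by rewrite [RHS]gK; apply/E; rewrite repK.
Qed.

End Presented.

(** * Finitely generated models of the axioms are generated by their atoms *)

Lemma generated_by_atoms (H : baseUMagmaType) (I : eqType) (g : I -> H) (s : seq I) :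
    trace_axioms H ->
    (forall x, exists2 w, {subset w <= s} & x = eval g w) ->
  forall x, exists2 w, {in w, forall i, atom (g i)} & x = eval g w.
Proof.
move=> axH; have [mA m1 m1r irr _] := axH.
have [n] := ubnP (size s); elim: n s => // n IH s; rewrite ltnS => len gen.
have [sat x|/existsPNP[i si iat]] := pselect {in s, forall i, atom (g i)}.
  by have [w ws ->] := gen x; exists w => // i /ws/sat.
pose s' := [seq j <- s | j != i].
apply: (IH s').
  apply: leq_trans len; rewrite size_filter -(count_predC (pred1 i) s).
  by rewrite -[ltnLHS]add0n ltn_add2r -has_count has_pred1.
(* Substituting a word in the other generators for each occurrence of [i] eliminates [g i]. *)
suff [u us' iE] : exists2 u, {subset u <= s'} & g i = eval g u.
  move=> x; have [w ws ->] := gen x; elim: w ws {x} => [|j w IHw] ws /=.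
    by exists [::].
  have [|w' w's' ->] := IHw; first by move=> k kw; apply: ws; rewrite inE kw orbT.
  have [->|ji] := eqVneq j i.
    exists (u ++ w'); last by rewrite eval_cat // iE.
    by move=> k; rewrite mem_cat => /orP[/us'|/w's'].
  exists (j :: w') => // k; rewrite inE => /predU1P[->|/w's' //].
  by rewrite mem_filter ji ws ?mem_head.
have [->|gi1] := pselect (g i = 1); first by exists [::].
have [y [z [iE y1 z1]]] : exists y z, [/\ g i = y * z, y <> 1 & z <> 1].
  apply: contrapT => no; apply: iat; split=> // y z E.
  have [?|y1] := pselect (y = 1); first by left.
  by have [?|z1] := pselect (z = 1); [right|case: no; exists y, z].
have [[u us yE] [v vs zE]] := (gen y, gen z).
exists (u ++ v); last by rewrite iE yE zE eval_cat.
(* [x = u * x * v] forces [u = v = 1], so the generator [g i] occurs in neither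
   of its nontrivial factors [y] and [z]. *)
have unit2 (a b : H) : 1 = a * b -> a = 1 /\ b = 1.
  by move=> E; apply: (irr 1); rewrite m1r.
have split_at w : i \in w -> exists a b, eval g w = a * g i * b.
  case/splitPr => a b; exists (eval g a), (eval g b).
  by rewrite eval_cat //= mA.
move=> j; rewrite mem_cat mem_filter => juv.
apply/andP; split; last by case/orP: juv => [/us|/vs].
apply/eqP => ji; case/orP: juv; rewrite ji => /split_at[a [b]].
  rewrite -yE => yE'; case: z1; have [//|_ /esym/unit2[]//] := irr (g i) a (b * z).
  by rewrite {1}iE yE' !mA.
rewrite -zE => zE'; case: y1; have [//|/esym/unit2[]//] := irr (g i) (y * a) b.
by rewrite {1}iE zE' !mA.
Qed.

Lemma fg_words (H : baseUMagmaType) : trace_axioms H -> finitely_generated H ->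
  exists n (g : 'I_n -> H), forall x, exists w, x = eval g w.
Proof.
move=> axH [n [g gen]]; exists n, g => x; have [_ _ m1r _ _] := axH.
pose S : {pred H} := fun x => `[< exists w, x = eval g w >].
have /asboolP// : x \in S.
apply: gen => [|i]; last by apply/asboolP; exists [:: i]; rewrite /= m1r.
split=> [|y z /asboolP[u ->] /asboolP[v ->]]; apply/asboolP.
  by exists [::].
by exists (u ++ v); rewrite eval_cat.
Qed.

Lemma fg_eval_atoms (H : baseUMagmaType) (h : V -> H) :
    trace_axioms H -> finitely_generated H -> graph_of_atoms h ->
  forall x, exists w, x = eval h w.
Proof.
move=> axH fgH [_ _ hat _] x; have [n [g gen]] := fg_words axH fgH.
have [] := @generated_by_atoms _ _ g (enum 'I_n) axH _ x.
  by move=> y; have [w ->] := gen y; exists w => // i _; rewrite mem_enum.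
move=> w + ->; elim: w => [|i w IH] wat /=; first by exists [::].
have [|w' ->] := IH; first by move=> j jw; apply: wat; rewrite inE jw orbT.
have [v ->] := hat _ (wat i (mem_head _ _)).
by exists (v :: w').
Qed.

(** Every index [vvar N v] exceeds [N], so a tuple can be stored there without disturbing the
    variables below [N]. *)
Lemma vvar_surj (T : Type) N (h : V -> T) (env : nat -> T) :
  exists env' : nat -> T, (forall v, env' (vvar N v) = h v) /\
    forall j, j < N -> env' j = env j.
Proof.
pose env' j := oapp h (env j) [pick v | vvar N v == j].
exists env'; split=> [v|j jN]; rewrite /env'; case: pickP => [w /eqP|] /=.
- by case=> /addnI/ord_inj/enum_rank_inj ->.
- by move/(_ v); rewrite eqxx.
- move=> wj; have := leq_addr (enum_rank w).+3 N.
  by rewrite !addnS -/(vvar N w) wj leqNgt jN.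
- by [].
Qed.

(** * Quasi-finite axiomatizability and primality *)

Section Models.
Variables (G : baseUMagmaType) (p : seq V -> G).
Hypothesis pP : presents p.

Lemma presents_QFA : V -> QFA G.
Proof.
move=> v0; split; [exact: presents_infinite pP v0|exact: presents_fg pP|].
(* The second conjunct is the existential closure of [graph_of_atomsF 0], written through the
   universal one. *)
exists (MAnd (all_close trace_axiomsF)
         (MNot (all_close (MNot (graph_of_atomsF 0))))).
split.
- by rewrite /sentence /= !all_close_sentence.
- move=> env; split.
    by apply/holds_all_close/models_trace_axiomsF/presents_trace_axioms/pP.
  move=> /holds_all_close no.
  have [env' [env'E _]] := vvar_surj 0 (fun v => p [:: v]) env.
  apply: (no env'); apply/holds_graph_of_atomsF.
  by under eq_fun do rewrite env'E; apply: presents_graph_of_atoms.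
move=> H fgH Hmodels; pose env1 (_ : nat) : H := 1.
have [ax no] : holds env1 (all_close trace_axiomsF) /\
    ~ holds env1 (all_close (MNot (graph_of_atomsF 0))) := Hmodels env1.
have axH : trace_axioms H.
  by apply/models_trace_axiomsF; exact: (proj1 (holds_all_close _ _) ax).
have [env] : exists env : nat -> H, holds env (graph_of_atomsF 0).
  by apply: contrapT => none; apply/no/holds_all_close => env henv; apply: none; exists env.
move=> /holds_graph_of_atomsF hgr; have [_ _ ps _] := pP; have [rep repK] := choice ps.
apply: isomorphic_sym; have gen := fg_eval_atoms axH fgH hgr.
have [fM fB] := presents_eval_iso pP axH hgr gen repK.
by eexists; [exact: fM|].
Qed.

Definition word_term N (w : seq V) :=
  foldr (fun v => MMul (MVar (vvar N v))) MOne w.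

Lemma meval_word_term (H : baseUMagmaType) (env : nat -> H) N w :
  meval env (word_term N w) = eval (fun v => env (vvar N v)) w.
Proof. by elim: w => //= v w ->. Qed.

(* The tuple of generators has an isolated type: by [presents_eval_iso] any
   other tuple satisfying [graph_of_atomsF] is its image under an automorphism. *)
Lemma presents_elementary (H : baseUMagmaType) (h : V -> H) (rep : G -> seq V) :
    elementarily_equivalent G H -> graph_of_atoms h -> cancel rep p ->
  forall phi env, holds env phi -> holds (eval h \o rep \o env) phi.
Proof.
move=> GH hgr repK phi env phiE.
pose N := (\max_(j <- free_vars phi) j).+1.
have ltN j : j \in free_vars phi -> j < N.
  by move=> jphi; rewrite ltnS (@leq_bigmax_seq _ _ predT id).
(* The parameters [env j] are replaced by words in the generators, so [psi] mentions no element of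
   [G] and transfers to [H]. *)
pose psi := MImplies (graph_of_atomsF N)
  (MImplies (all_in (free_vars phi)
               (fun j => MEqual (MVar j) (word_term N (rep (env j))))) phi).
have Gpsi : models G psi.
  move=> env' /holds_graph_of_atomsF g'gr /holds_all_in /= env'E.
  (* Any such tuple [g'] in [G] induces an automorphism sending each [env j] to the value of its
     word at [g']. *)
  have gen := fg_eval_atoms (presents_trace_axioms pP) (presents_fg pP) g'gr.
  have [fM fB] := presents_eval_iso pP (presents_trace_axioms pP) g'gr gen repK.
  apply: (proj1 (holds_agree _) (proj1 (holds_iso fM fB phi env) phiE)).
  by move=> j jphi; rewrite env'E // meval_word_term.
have [env' [env'h env'E]] := vvar_surj N h (eval h \o rep \o env).
apply: (proj1 (holds_agree (env := env') _)); first by move=> j /ltN/env'E.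
have hE : (fun v => env' (vvar N v)) = h by apply: funext.
apply: (proj1 (elementarily_equivalent_models psi GH) Gpsi).
  by apply/holds_graph_of_atomsF; rewrite hE.
by apply/holds_all_in => j /ltN/env'E /= ->; rewrite meval_word_term hE.
Qed.

Lemma presents_prime_model : prime_model G.
Proof.
move=> H GH; have [_ _ ps _] := pP; have [rep repK] := choice ps.
have [env] : exists env : nat -> H, holds env (graph_of_atomsF 0).
  (* Otherwise the negation would be valid in [H], hence in [G], where the generators refute it. *)
  apply: contrapT => no.
  have /(elementarily_equivalent_models _ GH) :
      models H (MNot (graph_of_atomsF 0)) by move=> env henv; apply: no; exists env.
  have [env' [env'E _]] := vvar_surj 0 (fun v => p [:: v]) (fun=> 1).
  move=> /(_ env') /=; apply; apply/holds_graph_of_atomsF.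
  by under eq_fun do rewrite env'E; apply: presents_graph_of_atoms.
move=> /holds_graph_of_atomsF; set h := fun v => _ => hgr.
pose f := eval h \o rep.
have fE phi env' : holds env' phi <-> holds (f \o env') phi.
  split; first exact: presents_elementary.
  (* The converse is the forward direction for the negated formula. *)
  move=> hphi; apply: contrapT => no.
  exact: (presents_elementary GH hgr repK (phi := MNot phi) no).
(* Elementarity on atomic formulas makes [f] an injective morphism. *)
have f1 : f 1 = 1 := proj1 (fE (MEqual (MVar 0) MOne) (fun=> 1)) erefl.
have fM x y : f (x * y) = f x * f y.
  pose env' := nth 1 [:: x * y; x; y].
  exact: (proj1 (fE (MEqual (MVar 0) (MMul (MVar 1) (MVar 2))) env') erefl).
have finj : injective f.
  move=> x y fxy; pose env' := nth 1 [:: x; y].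
  exact: (proj2 (fE (MEqual (MVar 0) (MVar 1)) env') fxy).
pose S : {pred H} := fun y => `[< exists x, y = f x >].
have Sf x : f x \in S by apply/asboolP; exists x.
have clS : umagma_closed S.
  split=> [|_ _ /asboolP[x ->] /asboolP[y ->]]; first by rewrite -f1.
  by rewrite -fM.
pose F x : submodel clS := exist _ (f x) (Sf x).
have FM : monoid_morphism F by split=> [|x y]; apply: val_inj => /=.
have [g gK] : {g : submodel clS -> G & forall y, y = F (g y)}.
  apply: (choice (P := fun y x => y = F x)) => -[y Sy]; have /asboolP[x yE] := Sy.
  by exists x; apply: val_inj.
have FB : bijective F.
  exists g => // x; apply: finj; have := gK (F x).
  by move/(congr1 sval).
exists S, clS; split; last by exists F.
move=> phi env'.
have -> : env' = F \o (g \o env') by apply: funext => j /=.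
(* Truth passes from the submodel to [G] along the isomorphism [F], then from [G] to [H] by [fE]. *)
rewrite -(holds_iso FM FB) (fE phi).
by [].
Qed.

End Models.
End Presentation.

(** * The free partially commutative and free monoids as presented monoids *)

Lemma fpc_monoid_presents (V : finType) (e : rel V) : presents e (@fpc_pi V e).
Proof.
split=> // [u v|x|u v]; first by rewrite -fpc_mul_pi.
  by exists (repr x); apply: fpc_piK.
exact: fpc_pi_eq.
Qed.

(** Without edges the congruence reduces to equality of words. *)
Lemma free_monoid_presents (X : finType) :
  @presents X (fun _ _ => false) (free_monoid X) id.
Proof.
split=> // [x|u v]; first by exists x.
by split=> [->|]; [apply: fpc_refl|elim=> // [{}u {}v w _ -> _ ->|{}u u' {}v v' _ -> _ ->]].
Qed.

Theorem mainTheorem6 :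
  (forall X : finType, 1 < #|X| ->
     QFA (free_monoid X) /\ prime_model (free_monoid X)) /\
  (forall (V : finType) (e : rel V), symmetric e -> irreflexive e ->
     (exists x : fpc_monoid e, x != 1%g) ->
     center (fpc_monoid e) = [set 1%g]%classic ->
     QFA (fpc_monoid e) /\ prime_model (fpc_monoid e)).
Proof.
split=> [X /ltnW/card_gt0P[x _]|V e e_sym _ [x x1] _].
  have P := free_monoid_presents X.
  by split; [apply: presents_QFA P x|apply: presents_prime_model P].
have P := fpc_monoid_presents e.
(* A nontrivial element is represented by a nonempty word, which supplies a vertex. *)
have [v _] : exists v : V, true.
  move: x1; rewrite -(fpc_piK x); case: (repr x) => [|v u]; first by rewrite eqxx.
  by exists v.
by split; [apply: presents_QFA P v|apply: presents_prime_model P].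
Qed.
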